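(* Let $\mu$ be a nonzero Radon measure on $\mathbb{R}$. Then the following conditions are equivalent: (1) $\mu$ is quasi-translation invariant; (2) $\{T_t\}_{t\in\mathbb{R}}$ acts as a group of linear operators on $L^\infty(\mu)$; (3) $\{T_t\}_{t\in\mathbb{R}}$ acts as a group of isometries on $L^\infty(\mu)$; (4) $\mu$ is equivalent to Lebesgue measure $m$.
   Context: A Radon measure on $\mathbb{R}$ is a positive Borel measure $\mu$ on $\mathbb{R}$ with $\mu([-n,n])<\infty$ for all $n\in\mathbb{N}$. $\mu$ is quasi-translation invariant if for every Borel set $E\subset\mathbb{R}$: $\mu(E)=0 \iff \mu(E+t)=0$ for all $t\in\mathbb{R}$. For an extended real-valued function $f$ on $\mathbb{R}$ and $t\in\mathbb{R}$, $T_t(f)(x)=f(x-t)$. Saying that $\{T_t\}_{t\in\mathbb{R}}$ acts as a group of linear operators (respectively isometries) on $L^\infty(\mu)$ means that each $T_t$ is well defined on $\mu$-a.e. equivalence classes of functions and defines a linear operator (respectively a linear isometry) of $L^\infty(\mu)$ into itself, with $T_s\circ T_t=T_{s+t}$ for all $s,t\in\mathbb{R}$ and $T_0=I$. Two measures are equivalent if each is absolutely continuous with respect to the other. *)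

(* Defs.v *)
From HB Require Import structures.
From mathcomp Require Import all_boot all_order all_algebra.
From mathcomp Require Import all_classical all_reals all_analysis.
From mathcomp Require Import measurable_realfun ess_sup_inf.

Set Implicit Arguments.
Unset Strict Implicit.
Unset Printing Implicit Defensive.
Import Order.TTheory GRing.Theory Num.Theory.
Import numFieldNormedType.Exports.

Local Open Scope classical_set_scope.
Local Open Scope ring_scope.
Local Open Scope quotient_scope.

(* MathComp-Analysis provides the Lp space as a quotient by a.e. equality
   without algebraic structure. This section makes it an lmodType, the
   operations being the pointwise ones on representatives (see Lspace_funD and
   Lspace_funZ). *)
Section Lspace_lmodType.
Context d (T : measurableType d) (R : realType).
Context (mu : {measure set T -> \bar R}) (p : \bar R) (p1 : (1 <= p)%E).
Local Notation L := (LspaceType mu p1).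

Lemma ae_eq_Lnorm (f g : T -> R) :
  measurable_fun setT f -> measurable_fun setT g -> f = g %[ae mu] ->
  'N[mu]_p[EFin \o f]%E = 'N[mu]_p[EFin \o g]%E.
Proof.
move=> mf mg fg; rewrite unlock /Lnorm; case: p p1 => [r r1| _ |//].
  have mpow (h : T -> R) : measurable_fun setT h ->
      measurable_fun setT (fun x => (`|(EFin \o h) x| `^ r)%E).
    move=> mh; apply/measurable_EFinP.
    apply: (@measurableT_comp _ _ _ _ _ _ (@powR R ^~ r)) => //.
    exact: measurableT_comp.
  congr (_ `^ _)%E; apply: ae_eq_integral => //; [exact: mpow|exact: mpow|].
  by apply: filterS fg => x fgx _ /=; rewrite fgx.
case: ifPn => // _; apply: eq_ess_sup.
by apply: filterS fg => x fgx /=; rewrite fgx.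
Qed.

Definition Lspace_fun (F : L) : T -> R :=
  (F : {mfun_ mu, T >-> measurableTypeR R}).

Lemma measurable_Lspace_fun (F : L) : measurable_fun setT (Lspace_fun F).
Proof.
exact: (measurable_funPT (repr (F : {mfun_ mu, T >-> measurableTypeR R}))).
Qed.

Lemma Lspace_fun_Lfun (F : L) : Lspace_fun F \in Lfun mu p.
Proof.
rewrite inE; apply/andP; split; rewrite inE/=.
  exact: measurable_Lspace_fun.
exact: (@Lebesgue_finite _ _ _ _ _ _ F).
Qed.

Definition Lspace_repr (F : L) : LfunType mu p1 :=
  Lfun_Sub p1 (Lspace_fun_Lfun F).

Lemma LfunType_mfun_subproof (f : LfunType mu p1) :
  (f : T -> measurableTypeR R) \in @mfun _ _ T (measurableTypeR R).
Proof. by rewrite inE; exact: (measurable_funPT f). Qed.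

Definition Lspace_mfun (f : LfunType mu p1) :
    {mfun_ mu, T >-> measurableTypeR R} :=
  \pi_{mfun_ mu, T >-> measurableTypeR R}
    (mfun_Sub (LfunType_mfun_subproof f)).

Lemma Lspace_mfunE (f : LfunType mu p1) :
  (Lspace_mfun f : T -> R) = (f : T -> R) %[ae mu].
Proof.
suff /eqmodP/asboolP : repr (Lspace_mfun f) =
    mfun_Sub (LfunType_mfun_subproof f)
    %[mod {mfun_ mu, T >-> measurableTypeR R}] by [].
by rewrite reprK.
Qed.

Lemma Lspace_mfun_finite (f : LfunType mu p1) :
  finite_norm mu p (Lspace_mfun f).
Proof.
rewrite /finite_norm (ae_eq_Lnorm _ _ (Lspace_mfunE f)).
- exact: Lfunction_finite.
- exact: (measurable_funPT (repr (Lspace_mfun f))).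
- exact: measurable_funPT.
Qed.

HB.instance Definition _ (f : LfunType mu p1) :=
  isFinLebesgue.Build d T R mu p p1 (Lspace_mfun f) (Lspace_mfun_finite f).

Definition Lspace_class (f : LfunType mu p1) : L := Lspace_mfun f.

Lemma Lspace_classK (f : LfunType mu p1) :
  Lspace_fun (Lspace_class f) = f %[ae mu].
Proof. exact: Lspace_mfunE. Qed.

Lemma Lspace_eqP (F G : L) : Lspace_fun F = Lspace_fun G %[ae mu] <-> F = G.
Proof.
split=> [FG|->]; last exact: aeW.
have : (F : {mfun_ mu, T >-> measurableTypeR R}) = G.
  by rewrite -[LHS]reprK -[RHS]reprK; apply/eqmodP/asboolP.
case: F G {FG} => F [[hF]] [G [[hG]]] /= FG; subst G.
by rewrite (Prop_irrelevance hF hG).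
Qed.

HB.instance Definition _ := gen_eqMixin L.
HB.instance Definition _ := gen_choiceMixin L.

Let add (F G : L) : L := Lspace_class (Lspace_repr F + Lspace_repr G).
Let opp (F : L) : L := Lspace_class (- Lspace_repr F).
Let scale (a : R) (F : L) : L := Lspace_class (a *: Lspace_repr F).
Let zero : L := Lspace_class 0.

Let addE (F G : L) :
  Lspace_fun (add F G) = Lspace_fun F \+ Lspace_fun G %[ae mu].
Proof. exact: Lspace_classK. Qed.
Let oppE (F : L) : Lspace_fun (opp F) = \- Lspace_fun F %[ae mu].
Proof. exact: Lspace_classK. Qed.
Let scaleE a (F : L) : Lspace_fun (scale a F) = a \*: Lspace_fun F %[ae mu].
Proof. exact: Lspace_classK. Qed.
Let zeroE : Lspace_fun zero = cst 0 %[ae mu].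
Proof. exact: Lspace_classK. Qed.


Let addA : associative add.
Proof.
move=> F G H; apply/Lspace_eqP; near=> x => _.
rewrite (near (addE F (add G H)) x)//= (near (addE G H) x)//=.
by rewrite (near (addE (add F G) H) x)//= (near (addE F G) x)//= addrA.
Unshelve. all: by end_near. Qed.

Let addC : commutative add.
Proof.
move=> F G; apply/Lspace_eqP; have := addE F G; have := addE G F.
by apply: filterS2 => x /(_ I) /= h1 /(_ I) /= h2 _; rewrite h1 h2 addrC.
Qed.

Let add0 : left_id zero add.
Proof.
move=> F; apply/Lspace_eqP; have := addE zero F; have := zeroE.
by apply: filterS2 => x /(_ I) /= h1 /(_ I) /= h2 _; rewrite h2 h1 add0r.
Qed.

Let addN : left_inverse zero opp add.
Proof.
move=> F; apply/Lspace_eqP.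
have := addE (opp F) F; have := oppE F; have := zeroE.
apply: filterS3 => x /(_ I) /= h1 /(_ I) /= h2 /(_ I) /= h3 _.
by rewrite h3 h2 h1 addNr.
Qed.

HB.instance Definition _ := GRing.isZmodule.Build L addA addC add0 addN.

Let scaleA a b F : scale a (scale b F) = scale (a * b) F.
Proof.
apply/Lspace_eqP.
have := scaleE a (scale b F); have := scaleE b F; have := scaleE (a * b) F.
apply: filterS3 => x /(_ I) /= h1 /(_ I) /= h2 /(_ I) /= h3 _.
by rewrite h3 h2 h1 scalerA.
Qed.

Let scale1 : left_id 1 scale.
Proof.
move=> F; apply/Lspace_eqP; have := scaleE 1 F.
by apply: filterS => x /(_ I) /= h _; rewrite h scale1r.
Qed.

Let scaleDr : right_distributive scale +%R.
Proof.
move=> a F G; apply/Lspace_eqP; near=> x => _.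
rewrite (near (scaleE a (F + G)) x)//= (near (addE F G) x)//=.
rewrite (near (addE (scale a F) (scale a G)) x)//=.
by rewrite (near (scaleE a F) x)// (near (scaleE a G) x)// scalerDr.
Unshelve. all: by end_near. Qed.

Let scaleDl F : {morph scale^~ F : a b / a + b}.
Proof.
move=> a b; apply/Lspace_eqP; near=> x => _.
rewrite (near (scaleE (a + b) F) x)//=.
rewrite (near (addE (scale a F) (scale b F)) x)//=.
by rewrite (near (scaleE a F) x)// (near (scaleE b F) x)// scalerDl.
Unshelve. all: by end_near. Qed.

HB.instance Definition _ :=
  GRing.Zmodule_isLmodule.Build R L scaleA scale1 scaleDr scaleDl.

Lemma Lspace_funD (F G : L) :
  Lspace_fun (F + G) = Lspace_fun F \+ Lspace_fun G %[ae mu].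
Proof. exact: addE. Qed.

Lemma Lspace_funZ (a : R) (F : L) :
  Lspace_fun (a *: F) = a \*: Lspace_fun F %[ae mu].
Proof. exact: scaleE. Qed.

End Lspace_lmodType.

(* measurableTypeR R is R with its Borel sigma-algebra, generated by the
   half-open intervals. *)
Definition radon_measure (R : realType)
    (mu : {measure set (measurableTypeR R) -> \bar R}) : Prop :=
  forall n : nat, (mu `[(- n%:R)%R, n%:R%R]%classic < +oo)%E.

Definition quasi_translation_invariant (R : realType)
    (mu : {measure set (measurableTypeR R) -> \bar R}) : Prop :=
  forall E : set (measurableTypeR R), measurable E ->
  forall t : R, mu E = 0%E <-> mu [set x + t | x in E] = 0%E.

Definition translate (R : realType) (t : R) (f : measurableTypeR R -> \bar R) :
    measurableTypeR R -> \bar R :=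
  fun x => f (x - t).

Definition Linfty (R : realType)
    (mu : {measure set (measurableTypeR R) -> \bar R}) : lmodType R :=
  LspaceType mu (leey 1 : (1 <= +oo)%E).

Definition Linfty_norm (R : realType)
    (mu : {measure set (measurableTypeR R) -> \bar R}) (F : Linfty mu) : \bar R :=
  'N[mu]_+oo[EFin \o Lspace_fun F]%E.

(* Elements of the library's Lp spaces have real-valued representatives; an
   essentially bounded extended real-valued function is a.e. finite, so it
   belongs to exactly one such class. *)
Definition represents (R : realType)
    (mu : {measure set (measurableTypeR R) -> \bar R})
    (f : measurableTypeR R -> \bar R) (F : Linfty mu) : Prop :=
  measurable_fun setT f /\ f = EFin \o Lspace_fun F %[ae mu].

Definition translate_well_defined (R : realType)
    (mu : {measure set (measurableTypeR R) -> \bar R}) (t : R) : Prop :=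
  forall f g : measurableTypeR R -> \bar R,
    measurable_fun setT f -> measurable_fun setT g ->
    f = g %[ae mu] -> translate t f = translate t g %[ae mu].

(* U t is the operator that the translation by t defines on classes. *)
Definition translate_linear_group (R : realType)
    (mu : {measure set (measurableTypeR R) -> \bar R})
    (U : R -> Linfty mu -> Linfty mu) : Prop :=
  [/\ forall t, translate_well_defined mu t,
      forall t f (F : Linfty mu),
        represents f F -> represents (translate t f) (U t F),
      forall t, linear (U t),
      forall s t, U s \o U t = U (s + t)
    & U 0 = id].

Definition acts_by_linear_operators (R : realType)
    (mu : {measure set (measurableTypeR R) -> \bar R}) : Prop :=
  exists U : R -> Linfty mu -> Linfty mu, translate_linear_group U.

Definition acts_by_isometries (R : realType)
    (mu : {measure set (measurableTypeR R) -> \bar R}) : Prop :=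
  exists U : R -> Linfty mu -> Linfty mu,
    translate_linear_group U /\
    forall t F, Linfty_norm (U t F) = Linfty_norm F.

Definition equivalent_measures d (T : measurableType d) (R : realType)
    (mu nu : {measure set T -> \bar R}) : Prop :=
  mu `<< nu /\ nu `<< mu.

(* Main.v *)
From HB Require Import structures.
Require Import Defs.
From mathcomp Require Import all_boot all_order all_algebra.
From mathcomp Require Import all_classical all_reals all_analysis.
From mathcomp Require Import measurable_realfun ess_sup_inf.

Import Order.TTheory GRing.Theory Num.Theory.

Local Open Scope classical_set_scope.
Local Open Scope ring_scope.

(** Everything goes through null sets.

    Quasi-translation invariance says that translating preserves null sets,
    hence a.e. statements ([ae_translate]); this is what is needed for [T_t]
    to be defined on a.e. classes, and conversely applying [T_t] to the class
    of the indicator of a null set, which is the class of 0, gives the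
    invariance back ([translate_well_definedP]). Under it the essential
    supremum cannot increase under [T_t], nor under its inverse [T_(-t)], so
    that [T_t] preserves the norm ([Lnorm_pinfty_translate]). Thus (1), (2) and
    (3) are equivalent.

    Lebesgue measure [m] is translation invariant, so a measure with the same
    null sets is quasi-translation invariant: (4) implies (1). For the converse,
    apply Tonelli's theorem to the set of the [(x, y)] with [x + y] in [E], for
    the product of [mu] and [m]. Its sections at fixed [x] are translates of
    [E], all of measure [m E], so that ([integral_measure_translate])

      [\int mu (E - y) dm(y) = m E * mu R].

    If [mu E = 0], the left-hand side vanishes by invariance, and [m E = 0]
    since [mu R > 0]. If [m E = 0], then [mu (E - y) = 0] for [m]-almost every
    [y], hence for at least one [y], and [mu E = 0] by invariance. The Radon
    hypothesis makes [mu] sigma-finite, as Tonelli's theorem demands. *)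

(** * Translations of the line *)

Lemma image_translate {R : realType} (E : set (measurableTypeR R)) (t : R) :
  [set x + t | x in E] = (fun x : measurableTypeR R => x - t) @^-1` E.
Proof.
apply/seteqP; split => [_ [x Ex <-]|x Ex] /=; first by rewrite addrK.
by exists (x - t) => //; rewrite subrK.
Qed.

Lemma preimage_translateK {R : realType} (E : set (measurableTypeR R))
    (s t : R) : s + t = 0 ->
  (fun x : measurableTypeR R => x + s) @^-1`
    ((fun x : measurableTypeR R => x + t) @^-1` E) = E.
Proof.
by move=> st0; apply/seteqP; split => x /=; rewrite -addrA st0 addr0.
Qed.

Lemma measurable_fun_translate {R : realType} (t : R) :
  measurable_fun setT (fun x : measurableTypeR R => x + t : measurableTypeR R).
Proof. exact: measurable_funD. Qed.

Lemma measurable_translate_set {R : realType} (E : set (measurableTypeR R))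
    (t : R) :
  measurable E ->
  measurable ((fun x : measurableTypeR R => x + t) @^-1` E).
Proof.
move=> mE; rewrite -[X in measurable X]setTI.
exact: (measurable_fun_translate t).
Qed.

Lemma measurable_translate {R : realType} (t : R)
    (f : measurableTypeR R -> \bar R) :
  measurable_fun setT f -> measurable_fun setT (translate t f).
Proof.
by move=> mf; apply: (measurableT_comp mf); exact: measurable_fun_translate.
Qed.

(** By uniqueness of Lebesgue measure it suffices to compare the lengths of
    half-open intervals. *)
Lemma lebesgue_measure_translate {R : realType} (E : set (measurableTypeR R))
    (t : R) : measurable E ->
  lebesgue_measure ((fun x : measurableTypeR R => x + t) @^-1` E) =
  lebesgue_measure E.
Proof.
move=> mE; pose f (x : measurableTypeR R) : measurableTypeR R := x + t.
pose g : {mfun measurableTypeR R >-> measurableTypeR R} :=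
  mfun_Sub (mem_set (measurable_fun_translate t) : f \in mfun).
apply/esym.
apply: (@lebesgue_measure_unique R (pushforward lebesgue_measure g)) => //=.
move=> _ [[a b]] _ <-; rewrite /pushforward /=.
have -> : f @^-1` `]a, b] = `]a - t, b - t]%classic.
  by apply/seteqP; split => x; rewrite /f/= !in_itv/= ltrBlDr lerBrDr.
rewrite !lebesgue_measure_itv/= !lte_fin ltrD2r; case: ifPn => // _.
by rewrite -!EFinB opprB addrA subrK.
Qed.

Lemma lebesgue_measureT_gt0 {R : realType} :
  (0 < @lebesgue_measure R setT)%E.
Proof.
apply: (@lt_le_trans _ _ (lebesgue_measure (`[0, 1] : set R))).
  by rewrite lebesgue_measure_itv/= lte_fin ltr01 oppr0 adde0 lte_fin ltr01.
by apply: le_measure; rewrite ?inE.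
Qed.

(** * Quasi-translation invariance and Lebesgue measure *)

Lemma radon_sigma_finite {R : realType}
    (mu : {measure set (measurableTypeR R) -> \bar R}) :
  radon_measure mu -> sigma_finite setT mu.
Proof.
move=> muR; exists (fun n => `[(- n%:R)%R, n%:R%R]%classic).
  by rewrite bigcup_itvT.
by move=> n; split; [exact: measurable_itv|exact: muR].
Qed.

Section radon_mu.
Context {R : realType} (mu : {measure set (measurableTypeR R) -> \bar R}).
Context (rmu : radon_measure mu).

(** A copy of [mu] whose argument records that [mu] is Radon, so that the
    structure of sigma-finite measure can be inferred for it. *)
Definition radon_mu (_ : radon_measure mu) :
  set (measurableTypeR R) -> \bar R := mu.

HB.instance Definition _ := Measure.on (radon_mu rmu).
HB.instance Definition _ :=
  Measure_isSigmaFinite.Build _ _ _ (radon_mu rmu)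
    (radon_sigma_finite mu rmu).

End radon_mu.

(** Tonelli's theorem for [mu], Lebesgue measure [m] and the set [A] of the
    [(x, y)] such that [x + y] lies in [E]: the sections of [A] are translates
    of [E] on both sides, and those taken at fixed [x] all have measure [m E].
    The measurability of [G] is part of the conclusion because deducing that
    [G] vanishes a.e. from its integral requires it. *)
Lemma integral_measure_translate {R : realType}
    (mu : {sigma_finite_measure set (measurableTypeR R) -> \bar R})
    (E : set (measurableTypeR R)) : measurable E ->
  let G y := mu ((fun x : measurableTypeR R => x + y) @^-1` E) in
  measurable_fun setT G /\
  (\int[lebesgue_measure]_y G y = lebesgue_measure E * mu setT)%E.
Proof.
move=> mE G.
pose A : set (measurableTypeR R * measurableTypeR R) :=
  (fun z => z.1 + z.2) @^-1` E.
have mA : measurable A.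
  rewrite -[X in measurable X]setTI.
  have : measurable_fun setT
      (fun z : measurableTypeR R * measurableTypeR R =>
         z.1 + z.2 : measurableTypeR R) by exact: measurable_funD.
  exact.
have GE : G = mu \o ysection A.
  apply/funext => y /=; congr (mu _).
  by apply/seteqP; split => x; rewrite /ysection/= inE.
split; first by rewrite GE; exact: measurable_fun_ysection.
have := indic_fubini_tonelli mu lebesgue_measure mA.
rewrite indic_fubini_tonelli_FE// indic_fubini_tonelli_GE// -GE => <-.
rewrite -integral_cst//; apply: eq_integral => x _ /=.
rewrite -[RHS](lebesgue_measure_translate _ x mE); congr lebesgue_measure.
by apply/seteqP; split => y; rewrite /xsection/= inE /A/= addrC.
Qed.

(** One implication, for null sets and preimages, is enough: the other one is
    the same implication for the opposite translation, and preimages are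
    what measurability and composition of functions deal with. *)
Lemma quasi_translation_invariantP {R : realType}
    (mu : {measure set (measurableTypeR R) -> \bar R}) :
  quasi_translation_invariant mu <->
  (forall E, measurable E -> mu E = 0%E ->
   forall t, mu ((fun x : measurableTypeR R => x + t) @^-1` E) = 0%E).
Proof.
split=> [qti E mE E0 t|shift0 E mE t].
  have := (qti E mE (- t)).1 E0; rewrite image_translate.
  by under eq_fun do rewrite opprK.
rewrite image_translate; split; first by move=> E0; exact: shift0.
move=> /(shift0 _ (measurable_translate_set _ _ mE)) => /(_ t).
by rewrite preimage_translateK// subrr.
Qed.

Lemma quasi_translation_invariant_equivalent {R : realType}
    (mu : {measure set (measurableTypeR R) -> \bar R}) :
  radon_measure mu -> (0 < mu setT)%E -> quasi_translation_invariant mu ->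
  equivalent_measures mu lebesgue_measure.
Proof.
move=> rmu mu0 /quasi_translation_invariantP qti.
split; apply/null_content_dominatesP => E mE E0;
  have [mG] := integral_measure_translate (radon_mu mu rmu) E mE;
  rewrite /radon_mu/=.
- rewrite E0 mul0e => intG.
  have : ae_eq lebesgue_measure setT
      (fun y : measurableTypeR R =>
         mu ((fun x : measurableTypeR R => x + y) @^-1` E)) (cst 0%E).
    by apply/ae_eq_integral_abs => //; under eq_integral do rewrite gee0_abs//.
  have := ae_properfilter_algebraOfSetsType (@lebesgue_measureT_gt0 R).
  move=> pf /filter_ex[y] /(_ I) /= muEy.
  have := qti _ (measurable_translate_set _ y mE) muEy (- y).
  by rewrite preimage_translateK// addNr.
- under eq_integral do rewrite qti//.
  rewrite integral0 => /esym/eqP; rewrite mule_eq0 => /orP[/eqP//|].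
  by rewrite gt_eqF.
Qed.

Lemma equivalent_quasi_translation_invariant {R : realType}
    (mu : {measure set (measurableTypeR R) -> \bar R}) :
  equivalent_measures mu lebesgue_measure -> quasi_translation_invariant mu.
Proof.
move=> [/null_content_dominatesP mul /null_content_dominatesP lmu].
apply/quasi_translation_invariantP => E mE /(lmu _ mE) E0 t.
apply: mul; first exact: measurable_translate_set.
exact: etrans (lebesgue_measure_translate _ t mE) E0.
Qed.

(** * Translations acting on classes of functions *)

Lemma ae_translate {R : realType}
    (mu : {measure set (measurableTypeR R) -> \bar R}) (t : R)
    (P : set (measurableTypeR R)) :
  quasi_translation_invariant mu ->
  (\forall x \ae mu, P x) -> \forall x \ae mu, P (x - t).
Proof.
move=> /quasi_translation_invariantP qti [N [mN N0 PN]].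
exists ((fun x : measurableTypeR R => x - t) @^-1` N); split.
- exact: measurable_translate_set.
- exact: qti.
- by move=> x /= nPx; apply: PN.
Qed.

(** Instance resolution does not see through [measurableTypeR R] to the general
    statement about measures on an abstract space. *)
#[local] Instance ae_filter_measurableTypeR {R : realType}
  (mu : {measure set (measurableTypeR R) -> \bar R}) :
  Filter (nbhs (almost_everywhere mu)).
Proof. exact: (@ae_filter_ringOfSetsType _ (measurableTypeR R)). Qed.

(** For the converse, a null set [E] makes the indicator of [E] a.e. equal to 0,
    so that its translates, which are the indicators of the translates of [E],
    are a.e. equal to 0 as well. *)
Lemma translate_well_definedP {R : realType}
    (mu : {measure set (measurableTypeR R) -> \bar R}) :
  quasi_translation_invariant mu <-> forall t, translate_well_defined mu t.
Proof.
split=> [qti t f g _ _ fg|wd].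
  by have := ae_translate _ t _ qti fg; apply: filterS => x /(_ I).
apply/quasi_translation_invariantP => E mE E0 t.
have mI : measurable_fun setT (EFin \o \1_E : measurableTypeR R -> \bar R).
  exact/measurable_EFinP/measurable_indic.
have I0 : (EFin \o \1_E : measurableTypeR R -> \bar R) = cst 0%E %[ae mu].
  exists E; split => // x /=; apply: contra_notP => nEx _.
  by rewrite indicE memNset.
have := wd (- t) _ _ mI (measurable_cst _) I0.
move=> [N [mN N0 EN]]; apply: (subset_measure0 _ mN _ N0).
  exact: measurable_translate_set.
move=> x /= Ex; apply: EN => /= /(_ I).
by rewrite /translate/= opprK indicE mem_set//= => -[] /eqP; rewrite oner_eq0.
Qed.

(** An a.e. bound of [f] is an a.e. bound of its translates, so translating does
    not increase the norm; translating back gives the other inequality. *)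
Lemma Lnorm_pinfty_translate {R : realType}
    (mu : {measure set (measurableTypeR R) -> \bar R}) (t : R)
    (f : measurableTypeR R -> \bar R) :
  quasi_translation_invariant mu ->
  ('N[mu]_+oo[translate t f] = 'N[mu]_+oo[f])%E.
Proof.
move=> qti; suff le s g : ('N[mu]_+oo[translate s g] <= 'N[mu]_+oo[g])%E.
  apply/eqP; rewrite eq_le le /=; apply: le_trans (le (- t) _).
  rewrite le_eqVlt; apply/orP; left; apply/eqP/eq_Lnorm => x.
  by rewrite /translate opprK addrK.
rewrite unlock; case: ifPn => // _; apply/ess_supP.
exact: (ae_translate _ _ _ qti (ess_sup_ge mu (abse \o g))).
Qed.

Lemma Linfty_norm_represents {R : realType}
    (mu : {measure set (measurableTypeR R) -> \bar R}) f (F : Linfty mu) :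
  represents f F -> Linfty_norm F = ('N[mu]_+oo[f])%E.
Proof.
move=> [_ fF]; rewrite /Linfty_norm unlock; case: ifPn => // _.
by apply: eq_ess_sup; apply: filterS fF => x /= ->.
Qed.

Lemma represents_Lspace_fun {R : realType}
    (mu : {measure set (measurableTypeR R) -> \bar R}) (F : Linfty mu) :
  represents (EFin \o Lspace_fun F) F.
Proof.
by split; [exact/measurable_EFinP/measurable_Lspace_fun|exact: aeW].
Qed.

Section translation_operator.
Context {R : realType} (mu : {measure set (measurableTypeR R) -> \bar R}).
Context (qti : quasi_translation_invariant mu).

Lemma Lfun_translate (t : R) (F : Linfty mu) :
  (fun x => Lspace_fun F (x - t)) \in Lfun mu +oo%E.
Proof.
have /andP[] := Lspace_fun_Lfun F; rewrite !inE/= => mF finF.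
apply/andP; split; rewrite inE/=.
  by apply: (measurableT_comp mF); exact: measurable_fun_translate.
by rewrite /finite_norm (Lnorm_pinfty_translate mu t (EFin \o Lspace_fun F)).
Qed.

(** The operator is forced by what [T_t] does to representatives; the norm
    equality provides the finite norm that membership of [Linfty] requires. *)
Definition translation_operator (t : R) (F : Linfty mu) : Linfty mu :=
  Lspace_class (Lfun_Sub (leey 1) (Lfun_translate t F)).

Lemma translation_operatorE t F :
  Lspace_fun (translation_operator t F) =
  (fun x => Lspace_fun F (x - t)) %[ae mu].
Proof. exact: Lspace_classK. Qed.

Lemma translation_operator_represents t f F :
  represents f F -> represents (translate t f) (translation_operator t F).
Proof.
move=> [mf fF]; split; first exact: measurable_translate.
have := ae_translate _ t _ qti fF; have := translation_operatorE t F.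
by apply: filterS2 => x /(_ I) /= UF /(_ I) /= fFx _; rewrite /translate fFx UF.
Qed.

Lemma translation_operator_linear t : linear (translation_operator t).
Proof.
move=> a F G; apply/Lspace_eqP; near=> x => _.
rewrite (near (translation_operatorE t (a *: F + G)) x)//.
rewrite (near (Lspace_funD (a *: translation_operator t F)
  (translation_operator t G)) x)//=.
rewrite (near (Lspace_funZ a (translation_operator t F)) x)//=.
rewrite (near (translation_operatorE t F) x)//.
rewrite (near (translation_operatorE t G) x)//.
rewrite (near (ae_translate _ t _ qti (Lspace_funD (a *: F) G)) x)//=.
by rewrite (near (ae_translate _ t _ qti (Lspace_funZ a F)) x).
Unshelve. all: by end_near. Qed.

Lemma translation_operatorD s t :
  translation_operator s \o translation_operator t =
  translation_operator (s + t).
Proof.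
apply/funext => F; apply/Lspace_eqP; near=> x => _ /=.
rewrite (near (translation_operatorE s (translation_operator t F)) x)//.
rewrite (near (translation_operatorE (s + t) F) x)//.
rewrite (near (ae_translate _ s _ qti (translation_operatorE t F)) x)//.
by rewrite opprD addrA.
Unshelve. all: by end_near. Qed.

Lemma translation_operator0 : translation_operator 0 = id.
Proof.
apply/funext => F; apply/Lspace_eqP.
by apply: filterS (translation_operatorE 0 F) => x UF _; rewrite UF// subr0.
Qed.

Lemma translation_operator_group : translate_linear_group translation_operator.
Proof.
split.
- exact/translate_well_definedP.
- exact: translation_operator_represents.
- exact: translation_operator_linear.
- exact: translation_operatorD.
- exact: translation_operator0.
Qed.

End translation_operator.

(** [U t F] is represented by the translate of any representative of [F], so
    that the invariance of the norm of functions passes to classes. *)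
Lemma translate_linear_group_isometry {R : realType}
    (mu : {measure set (measurableTypeR R) -> \bar R}) U :
  @translate_linear_group R mu U ->
  forall t F, Linfty_norm (U t F) = Linfty_norm F.
Proof.
move=> [/translate_well_definedP qti repU _ _ _] t F.
have rF := represents_Lspace_fun mu F.
rewrite (Linfty_norm_represents _ _ _ (repU t _ _ rF)).
by rewrite Lnorm_pinfty_translate.
Qed.

Theorem theorem3 (R : realType)
    (mu : {measure set (measurableTypeR R) -> \bar R})
    (mu_radon : radon_measure mu)
    (mu_nonzero : exists2 E, measurable E & mu E <> 0%E) :
  [<-> quasi_translation_invariant mu;
       acts_by_linear_operators mu;
       acts_by_isometries mu;
       equivalent_measures mu lebesgue_measure].
Proof.
have muT : (0 < mu setT)%E.
  have [E mE /eqP E0] := mu_nonzero.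
  apply: (@lt_le_trans _ _ (mu E)); first by rewrite lt0e E0 measure_ge0.
  by apply: le_measure; rewrite ?inE.
tfae.
- by move=> qti; exists (translation_operator mu qti);
    exact: translation_operator_group.
- move=> [U gU]; exists U; split => //.
  exact: translate_linear_group_isometry.
- move=> [U [[/translate_well_definedP qti _ _ _ _] _]].
  exact: quasi_translation_invariant_equivalent.
- exact: equivalent_quasi_translation_invariant.
Qed.
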